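(* Let $m\ge3$ be an integer and $p\in(0,1)$. Then there exists a unique $\sigma_m$-invariant ergodic probability measure $\lambda_p$ on $(\Lambda_m,\mathcal{B}(\Lambda_m))$ equivalent to $\mu_p$, where $\lambda_p$ is defined by $$\lambda_p(B):=\lim_{n\to\infty}\frac1n\sum_{k=0}^{n-1}\sigma_m^k\mu_p(B)\quad\text{for }B\in\mathcal{B}(\Lambda_m).$$
   Context: For an integer $m\ge3$, $\Lambda_m$ is the set of sequences $w\in\{0,1\}^{\mathbb{N}}$ not containing $0^m$ or $1^m$ (as a block of consecutive digits), $\Lambda_m^n$ is the set of words $w\in\{0,1\}^n$ not containing $0^m$ or $1^m$, and $\Lambda_m^*=\bigcup_{n\ge1}\Lambda_m^n$. $\Lambda_m$ carries the metric $d_2(w,v)=2^{-\inf\{k\ge0:w_{k+1}\neq v_{k+1}\}}$ ($2^{-\infty}=0$), $\mathcal{B}(\Lambda_m)$ is its Borel sigma-algebra, and $\sigma_m:\Lambda_m\to\Lambda_m$ is the restriction of the shift $w_1w_2\cdots\mapsto w_2w_3\cdots$. For $w\in\Lambda_m^*$, the cylinder is $[w]:=\{v\in\Lambda_m:v\text{ begins with }w\}$. The $(p,1-p)$ Bernoulli-type measure $\mu_p$ is the unique measure on $(\Lambda_m,\mathcal{B}(\Lambda_m))$ with $\mu_p(\emptyset)=0$, $\mu_p(\Lambda_m)=1$, $\mu_p[0]=p$, $\mu_p[1]=1-p$, and, for every $n\ge1$ and $w\in\Lambda_m^n$: if $w0,w1\in\Lambda_m^{n+1}$ then $\mu_p[w0]=p\,\mu_p[w]$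 and $\mu_p[w1]=(1-p)\mu_p[w]$; if $w0\in\Lambda_m^{n+1}$ but $w1\notin\Lambda_m^{n+1}$ then $\mu_p[w0]=\mu_p[w]$; if $w1\in\Lambda_m^{n+1}$ but $w0\notin\Lambda_m^{n+1}$ then $\mu_p[w1]=\mu_p[w]$. $\sigma_m^k\mu_p(B):=\mu_p(\sigma_m^{-k}B)$. Two measures are equivalent if each is absolutely continuous with respect to the other. A $\sigma_m$-invariant probability measure is ergodic if every $A\in\mathcal{B}(\Lambda_m)$ with $\sigma_m^{-1}A=A$ has measure $0$ or $1$. *)

(* Defs.v *)
From HB Require Import structures.
From mathcomp Require Import all_boot all_order all_algebra.
From mathcomp Require Import all_classical all_reals all_analysis.

Set Implicit Arguments.
Unset Strict Implicit.
Unset Printing Implicit Defensive.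

Import Order.TTheory GRing.Theory Num.Theory.
Import numFieldNormedType.Exports.

Local Open Scope classical_set_scope.
Local Open Scope ring_scope.

(* The digits 0 and 1 are [false] and [true], and sequences are indexed from
   0: the digit w_{k+1} is [w k]. *)

Definition Lambda_set (m : nat) : set (nat -> bool) :=
  [set w | forall (b : bool) (k : nat),
     mkseq (fun i => w (k + i)%N) m != nseq m b].

(* [word m w] says that w is in Lambda_m^*, and in Lambda_m^n for n = size w. *)
Definition word (m : nat) (w : seq bool) : bool :=
  [&& (0 < size w)%N, ~~ infix (nseq m false) w & ~~ infix (nseq m true) w].

(* The type depends on R because the metric takes its values in R, and on the
   proof of 3 <= m because measurable types have to be inhabited. *)
Definition Lambda (R : realType) (m : nat) (hm : (3 <= m)%N) : Type :=
  Lambda_set m.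

Definition digit (R : realType) (m : nat) (hm : (3 <= m)%N)
  (w : Lambda R hm) : nat -> bool := val w.
Coercion digit : Lambda >-> Funclass.

Section Lambda_structures.
Context (R : realType) (m : nat) (hm : (3 <= m)%N).
Implicit Types u v w : Lambda R hm.

Lemma digit_inj : injective (@digit R m hm).
Proof. exact: val_inj. Qed.

Lemma digitP w (b : bool) (k : nat) :
  mkseq (fun i => w (k + i)%N) m != nseq m b.
Proof. by have := set_mem (valP w); apply. Qed.

Lemma odd_in_Lambda : odd \in Lambda_set m.
Proof.
apply/mem_set => b k; apply/eqP => /(congr1 (fun s => (nth b s 0, nth b s 1))).
rewrite !nth_mkseq ?nth_nseq ?(leq_trans _ hm)// addn0 addn1 /= => -[<-].
by case: (odd k).
Qed.

HB.instance Definition _ := Choice.copy (Lambda R hm) (set_type (Lambda_set m)).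

Definition alternating : Lambda R hm := SigSub odd_in_Lambda.
HB.instance Definition _ := isPointed.Build (Lambda R hm) alternating.

Definition d2 w v : R :=
  if pselect (exists k, w k != v k) is left ex then 2 ^- ex_minn ex else 0.

Lemma d2xx w : d2 w w = 0.
Proof. by rewrite /d2; case: pselect => // -[k kk]; exfalso; move: kk; rewrite eqxx. Qed.

Lemma d2_eq0 w v : d2 w v = 0 -> w = v.
Proof.
rewrite /d2; case: pselect => [ex /eqP|nex _].
  by rewrite invr_eq0 expf_eq0 pnatr_eq0 andbF.
apply/digit_inj/funext => k; apply/eqP; apply: contrapT => /negP wvk.
by apply: nex; exists k.
Qed.

Lemma d2_sym w v : d2 w v = d2 v w.
Proof.
rewrite /d2; case: pselect => [ex|nex]; case: pselect => [ex'|nex']//.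
- congr (2 ^- _); case: ex_minnP => i wvi lei; case: ex_minnP => j vwj lej.
  by apply/eqP; rewrite eqn_leq lei 1?eq_sym// lej 1?eq_sym.
- by case: nex'; case: ex => k; rewrite eq_sym; exists k.
- by case: nex; case: ex' => k; rewrite eq_sym; exists k.
Qed.

Lemma d2_ge0 w v : 0 <= d2 w v.
Proof. by rewrite /d2; case: pselect => // ex; rewrite invr_ge0 exprn_ge0. Qed.

Lemma d2_ge w v k : w k != v k -> 2 ^- k <= d2 w v.
Proof.
move=> wvk; rewrite /d2; case: pselect => [ex|[]]; last by exists k.
case: ex_minnP => i _ /(_ k wvk) ik.
by rewrite lef_pV2 ?posrE ?exprn_gt0// ler_weXn2l// ler1n.
Qed.

Lemma d2_triangle v w u : d2 w u <= d2 w v + d2 v u.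
Proof.
rewrite {1}/d2; case: pselect => [ex|_]; last by rewrite addr_ge0 ?d2_ge0.
case: ex_minnP => k wuk _; have [wvk|wvk] := eqVneq (w k) (v k).
  by rewrite ler_wpDl ?d2_ge0// d2_ge// -wvk.
by rewrite ler_wpDr ?d2_ge0// d2_ge.
Qed.

HB.instance Definition _ :=
  isMetric.Build R (Lambda R hm) d2xx d2_eq0 d2_sym d2_triangle.

(* [open] is taken in the topology of d2, so this is the Borel sigma-algebra. *)
HB.instance Definition _ :=
  Measurable.copy (Lambda R hm) (g_sigma_algebraType (@open (Lambda R hm))).

Lemma shift_in_Lambda w : (fun k => w k.+1) \in Lambda_set m.
Proof. by apply/mem_set => b k; exact: (digitP w b k.+1). Qed.

Definition sigma_shift w : Lambda R hm := SigSub (shift_in_Lambda w).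

Definition cylinder (w : seq bool) : set (Lambda R hm) :=
  [set v : Lambda R hm | mkseq v (size w) = w].

Local Open Scope ereal_scope.

(* mu set0 = 0 is part of the type of mu. These conditions determine mu on
   cylinders, hence on all measurable sets. *)
Definition is_bernoulli_type (p : R)
    (mu : {measure set (Lambda R hm) -> \bar R}) : Prop :=
  [/\ mu setT = 1,
      mu (cylinder [:: false]) = p%:E,
      mu (cylinder [:: true]) = (1 - p)%:E
    & forall w : seq bool, word m w ->
      [/\ word m (rcons w false) -> word m (rcons w true) ->
            mu (cylinder (rcons w false)) = p%:E * mu (cylinder w) /\
            mu (cylinder (rcons w true)) = (1 - p)%:E * mu (cylinder w),
          word m (rcons w false) -> ~~ word m (rcons w true) ->
            mu (cylinder (rcons w false)) = mu (cylinder w)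
        & word m (rcons w true) -> ~~ word m (rcons w false) ->
            mu (cylinder (rcons w true)) = mu (cylinder w)]].

Definition shift_invariant (lam : set (Lambda R hm) -> \bar R) : Prop :=
  forall B, measurable B -> pushforward lam sigma_shift B = lam B.

Definition ergodic (lam : set (Lambda R hm) -> \bar R) : Prop :=
  forall A, measurable A -> sigma_shift @^-1` A = A -> lam A = 0 \/ lam A = 1.

Definition equivalent (lam mu : set (Lambda R hm) -> \bar R) : Prop :=
  lam `<< mu /\ mu `<< lam.

End Lambda_structures.

(* Main.v *)
Require Import Defs.
From mathcomp Require Import all_boot all_order all_algebra.
From mathcomp Require Import all_classical all_reals all_analysis.
From mathcomp Require Import ring lra zify.

(* The run structure of a sequence (last digit, length of the current run) is a
   finite Markov chain under [mu].  Three steps suffice to forget the current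
   state, so the conditional probabilities of [shift^-k B] given the state all
   converge to the same limit, a mixture [lam] of the laws [nu s] of the future
   given the state [s], weighted by the stationary probabilities.

   Two states become indistinguishable after the next change of digit, which
   happens within [m] steps; hence the laws [nu s], [mu] and [lam] have the same
   null sets.  For a shift-invariant [A] the function [s |-> nu s A] is harmonic,
   hence constant, so [A] is independent of all cylinders and thus of itself.

   For uniqueness, the Hahn decomposition of the difference of two invariant
   measures can be made shift-invariant, so that ergodicity makes one of its two
   halves null. *)

Set Implicit Arguments.
Unset Strict Implicit.
Unset Printing Implicit Defensive.

Import Order.TTheory GRing.Theory Num.Theory.
Import numFieldNormedType.Exports.
Local Open Scope classical_set_scope.
Local Open Scope ring_scope.

(** * Invariant Hahn decompositions *)

Section invariant_hahn.
Local Open Scope ereal_scope.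
Local Open Scope charge_scope.
Context d (T : measurableType d) (R : realType).
Implicit Types nu : {charge set T -> \bar R}.

Lemma positive_setN nu P : nu.-positive_set P <-> (copp nu).-negative_set P.
Proof.
by split=> -[mP h]; split=> // A mA AP; have := h A mA AP; rewrite /copp oppe_le0.
Qed.

Lemma negative_setN nu P : nu.-negative_set P <-> (copp nu).-positive_set P.
Proof.
by split=> -[mP h]; split=> // A mA AP; have := h A mA AP; rewrite /copp oppe_ge0.
Qed.

Lemma sub_negative_set nu A B :
  measurable A -> A `<=` B -> nu.-negative_set B -> nu.-negative_set A.
Proof. by move=> mA AB [mB h]; split=> // C mC CA; exact/h/(subset_trans CA). Qed.

Lemma sub_positive_set nu A B :
  measurable A -> A `<=` B -> nu.-positive_set B -> nu.-positive_set A.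
Proof. by move=> mA AB [mB h]; split=> // C mC CA; exact/h/(subset_trans CA). Qed.

(** For [B] inside [Z], the charges of [B] and of the rest of [Z] are nonpositive and add up to 0,
    so both vanish. *)
Lemma negative_set_null nu Z : nu.-negative_set Z -> nu Z = 0 -> nu.-positive_set Z.
Proof.
move=> [mZ h] nuZ; split=> // B mB BZ.
have := chargeDI nu mZ mB; rewrite nuZ setIidr//.
have /h : measurable (Z `\` B) by exact: measurableD.
move=> /(_ (@subDsetl _ _ _)).
case: (nu (Z `\` B)) (fin_num_measure nu _ (measurableD mZ mB)) => // z _.
case: (nu B) (fin_num_measure nu _ mB) => // b _.
by rewrite !lee_fin => z0 [zb]; lra.
Qed.

Lemma positive_set_null nu Z : nu.-positive_set Z -> nu Z = 0 -> nu.-negative_set Z.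
Proof.
move=> /positive_setN nZ Z0; apply/negative_setN/negative_set_null => //.
by rewrite -[LHS]/(- nu Z) Z0 oppe0.
Qed.

Lemma bigcup_positive_set nu (F : (set T)^nat) :
  (forall i, nu.-positive_set (F i)) -> nu.-positive_set (\bigcup_i F i).
Proof.
by move=> h; apply/positive_setN/bigcup_negative_set => i; exact/positive_setN.
Qed.

Lemma positive_setU nu P Q :
  nu.-positive_set P -> nu.-positive_set Q -> nu.-positive_set (P `|` Q).
Proof.
by move=> /positive_setN hP /positive_setN hQ; exact/positive_setN/negative_setU.
Qed.

Context (nu : {charge set T -> \bar R}) (f : T -> T).
Hypothesis mf : measurable_fun [set: T] f.
Hypothesis nuf : forall B, measurable B -> nu (f @^-1` B) = nu B.

(* Invariance forces [P] and its preimage to differ by two sets of equal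
   charge, one of them positive and the other negative, hence both null. *)
Lemma preimage_hahn P : nu.-positive_set P -> nu.-negative_set (~` P) ->
  nu.-positive_set (f @^-1` P) /\ nu.-negative_set (~` (f @^-1` P)).
Proof.
move=> pP nP; have mP := pP.1.
have mfP : measurable (f @^-1` P) by rewrite -[X in measurable X]setTI; exact: mf.
have mD0 : measurable (P `\` f @^-1` P) by exact: measurableD.
have mD1 : measurable (f @^-1` P `\` P) by exact: measurableD.
have pD0 := sub_positive_set mD0 (@subDsetl _ _ _) pP.
have nD1 := sub_negative_set mD1 (@subDsetr _ _ _) nP.
have D01 : nu (P `\` f @^-1` P) = nu (f @^-1` P `\` P).
  have := nuf mP; rewrite (chargeDI nu mP mfP) (chargeDI nu mfP mP) setIC.
  move/(congr1 (fun x => x - nu (P `&` f @^-1` P))).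
  by rewrite !addeK// fin_num_measure//; exact: measurableI.
have nuD0 : nu (P `\` f @^-1` P) = 0.
  by apply/le_anti; rewrite {1}D01 (nD1.2 _ mD1)//= (pD0.2 _ mD0).
split.
  apply: (sub_positive_set mfP _ (positive_setU pP (negative_set_null nD1 _))).
    by move=> x fx; have [Px|Px] := pselect (P x); [left|right].
  by rewrite -D01.
apply: (sub_negative_set _ _ (negative_setU nP (positive_set_null pD0 nuD0))).
  exact: measurableC.
by move=> x fx; have [Px|Px] := pselect (P x); [right|left].
Qed.

(** The upper limit of the iterated preimages of a Hahn set is fixed exactly by the preimage map. It
    lies in a union of positive sets, and its complement in a union of negative ones. *)
Lemma invariant_Hahn_decomposition : exists A,
  [/\ f @^-1` A = A, nu.-positive_set A & nu.-negative_set (~` A)].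
Proof.
have [P [N [pP nN PN PN0]]] := Hahn_decomposition nu.
have nP : nu.-negative_set (~` P).
  apply: sub_negative_set nN; first exact: measurableC pP.1.
  by rewrite -[X in X `<=` _]setTI -PN => x [[]].
pose F n := iter n (preimage f) P.
have F_hahn n : nu.-positive_set (F n) /\ nu.-negative_set (~` F n).
  by elim: n => // n [? ?]; exact: preimage_hahn.
have mF n : measurable (F n) by exact: (F_hahn n).1.1.
have mA : measurable (lim_sup_set F).
  by apply: bigcapT_measurable => n; exact: bigcup_measurable.
exists (lim_sup_set F); split.
- apply/seteqP; split=> x /= h n _.
    by have [j /= nj Fj] := h n I; exists j.+1; [exact: leqW|].
  have [[//|j] /= nj Fj] := h n.+1 I; by exists j.
- apply: (sub_positive_set mA _ (bigcup_positive_set (fun n => (F_hahn n).1))).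
  by move=> x /(_ 0%N I) [j _ Fj]; exists j.
- apply: sub_negative_set (bigcup_negative_set (fun n => (F_hahn n).2)).
    exact: measurableC.
  rewrite setC_bigcap => x [n _] /= h; exists n => //= Fn.
  by apply: h; exists n => /=.
Qed.

End invariant_hahn.

(** * Uniqueness of invariant measures from ergodicity *)

Section ergodic_unique.
Local Open Scope ereal_scope.
Context d (T : measurableType d) (R : realType).

(** Take an invariant Hahn set [A] of [nu - lam]. Ergodicity and domination concentrate both
    measures on [A] or both on its complement, where the difference has constant sign, so the
    measures are comparable. *)
Lemma ergodic_unique (f : T -> T) (lam nu : probability T R) :
  measurable_fun [set: T] f ->
  (forall B, measurable B -> lam (f @^-1` B) = lam B) ->
  (forall B, measurable B -> nu (f @^-1` B) = nu B) ->
  (forall A, measurable A -> f @^-1` A = A -> lam A = 0 \/ lam A = 1) ->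
  nu `<< lam -> forall B, measurable B -> nu B = lam B.
Proof.
move=> mf lamf nuf erg /null_content_dominatesP nulam B mB.
pose k := cadd (charge_of_finite_measure nu) (copp (charge_of_finite_measure lam)).
have kE A : k A = nu A - lam A by [].
have kf A : measurable A -> k (f @^-1` A) = k A.
  by move=> mA; rewrite !kE lamf// nuf.
have [A [fA [mA pA] [mCA nA]]] := invariant_Hahn_decomposition mf kf.
(* An inequality between probabilities reverses on complements, hence is an equality. *)
have prob_le (m1 m2 : probability T R) : (forall C, measurable C -> m1 C <= m2 C) ->
    forall C, measurable C -> m1 C = m2 C.
  move=> h C mC; apply/le_anti; rewrite h//=.
  have := h _ (measurableC mC); rewrite !probability_setC//.
  rewrite -(fineK (fin_num_measure m1 _ mC)) -(fineK (fin_num_measure m2 _ mC)).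
  by rewrite -!EFinB !lee_fin lerD2l lerN2.
have null_split (m : probability T R) Z Y : measurable Z -> measurable Y ->
    m Z = 0 -> m Y = m (Y `\` Z).
  move=> mZ mY Z0; rewrite (measureDI _ mY mZ).
  rewrite [X in _ + X](_ : _ = 0) ?adde0//.
  apply: (subset_measure0 _ mZ _ Z0); [exact: measurableI|exact: subIsetr].
have [A0|A1] := erg A mA fA.
- apply: prob_le => // C mC.
  rewrite (null_split _ _ _ mA mC A0) (null_split _ _ _ mA mC (nulam _ mA A0)).
  rewrite -sube_le0; apply: nA; first exact: measurableD.
  exact: subDsetr.
have CA0 : lam (~` A) = 0 by rewrite probability_setC// A1 subee.
apply/esym; apply: prob_le => // C mC.
rewrite (null_split _ _ _ mCA mC CA0) (null_split _ _ _ mCA mC (nulam _ mCA CA0)).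
have mCA' : measurable (C `\` ~` A) by exact: measurableD.
rewrite -sube_ge0 ?fin_num_measure//; apply: pA => //.
by rewrite setDE setCK; exact: subIsetr.
Qed.

End ergodic_unique.

Section iterates.
Local Open Scope ereal_scope.

Lemma cesaro_pushforward (d : measure_display) (T : measurableType d) (R : realType)
    (mu : {measure set T -> \bar R}) (f : T -> T) (B : set T) (l : R) :
  (forall k, mu (iter k f @^-1` B) \is a fin_num) ->
  fine (mu (iter k f @^-1` B)) @[k --> \oo] --> l ->
  (fun n : nat => (n%:R^-1)%:E * \sum_(0 <= k < n) pushforward mu (iter k f) B)
    @ \oo --> l%:E.
Proof.
(* [arithmetic_mean] at [n] averages [n.+1] terms; the shift aligns the indices and drops the term
   at 0. *)
move=> fin /cesaro cvg; rewrite -cvg_shiftS.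
have E n : ((n.+1%:R^-1)%:E * \sum_(0 <= k < n.+1) pushforward mu (iter k f) B) =
    (arithmetic_mean (fun k => fine (mu (iter k f @^-1` B))) n)%:E.
  rewrite /arithmetic_mean EFinM seriesEnat -sumEFin; congr (_ * _).
  by apply: eq_bigr => k _; rewrite fineK.
rewrite (funext E); exact: cvg_EFin (nearW _ _) cvg.
Qed.

Lemma iter_preimage_id (T : Type) (f : T -> T) (A : set T) k :
  f @^-1` A = A -> iter k f @^-1` A = A.
Proof.
move=> fA; elim: k => // k IH; rewrite -[RHS]fA -[in RHS]IH.
by apply/seteqP; split=> x; rewrite /= -iterSr.
Qed.

End iterates.

(** * Cylinders *)

Lemma take_mkseq (T : Type) (f : nat -> T) (k n : nat) :
  (k <= n)%N -> take k (mkseq f n) = mkseq f k.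
Proof. by move=> kn; rewrite /mkseq -map_take take_iota (minn_idPl kn). Qed.

Lemma nseqSr (T : Type) (k : nat) (x : T) : nseq k.+1 x = rcons (nseq k x) x.
Proof. by elim: k => //= k <-. Qed.

Section cylinders.
Context {R : realType} {m : nat} {hm : (3 <= m)%N}.
Local Notation T := (Lambda R hm).
Local Notation cyl := (@cylinder R m hm).
Local Notation shift := (@sigma_shift R m hm).

Lemma cylinder_nil : cyl [::] = setT.
Proof. by apply/seteqP; split. Qed.

Lemma cylinder_cons b w : cyl (b :: w) = cyl [:: b] `&` shift @^-1` cyl w.
Proof.
apply/seteqP; split=> x; rewrite /cylinder /= /mkseq /= (iotaDl 1 0) -map_comp.
  by case=> <- xw; split.
by case=> -[<-] xw; congr cons.
Qed.

Lemma cylinder_cat v w :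
  cyl (v ++ w) = cyl v `&` iter (size v) shift @^-1` cyl w.
Proof.
elim: v => [|b v IH] /=; first by rewrite cylinder_nil setTI.
rewrite cylinder_cons IH preimage_setI setIA -cylinder_cons.
by congr (_ `&` _); apply/seteqP; split=> x; rewrite /= -iterSr.
Qed.

Lemma cylinder_rcons_sub w b : cyl (rcons w b) `<=` cyl w.
Proof. by rewrite -cats1 cylinder_cat; exact: subIsetl. Qed.

Lemma cylinderI v w : (size v <= size w)%N ->
  cyl v `&` cyl w = if prefix v w then cyl w else set0.
Proof.
move=> vw; rewrite prefixE; apply/seteqP; split=> x; last first.
  case: eqP => // <- xw; split=> //; rewrite -xw /cylinder /=.
  by rewrite size_takel ?take_mkseq// size_mkseq.
move=> [xv xw]; suff -> : take (size v) w == v by [].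
by rewrite -[in take _ _]xw take_mkseq// xv.
Qed.

Lemma cylinder_trivI w v : w != v -> size w = size v -> cyl w `&` cyl v = set0.
Proof.
move=> wv sz; rewrite cylinderI ?sz//; case: ifP => //.
by rewrite prefixE sz take_size eq_sym (negbTE wv).
Qed.

Lemma cylinder_rconsU w : cyl w = cyl (rcons w false) `|` cyl (rcons w true).
Proof.
apply/seteqP; split; last by move=> x [] /cylinder_rcons_sub.
move=> x xw; suff : cyl (rcons w (x (size w))) x.
  by case: (x (size w)) => ?; [right|left].
rewrite /cylinder /= size_rcons /mkseq -addn1 iotaD map_cat cats1.
by rewrite [X in rcons X]xw.
Qed.

Lemma cylinder_bool : cyl [:: false] `|` cyl [:: true] = setT.
Proof. by rewrite -cylinder_nil (cylinder_rconsU [::]). Qed.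

Lemma cylinder_infix w b : infix (nseq m b) w -> cyl w = set0.
Proof.
move=> /infixP [u [v ->]]; rewrite -subset0 => x xw.
move: xw; rewrite cylinder_cat cylinder_cat => -[_ [/= xb _]].
have /eqP[] := digitP (iter (size u) shift x) b 0.
by move: xb; rewrite /cylinder /= size_nseq.
Qed.

Lemma open_cylinder w : open (cyl w).
Proof.
rewrite openE => x xw; apply/nbhs_ballP; exists (2 ^- size w) => /=.
  by rewrite invr_gt0 exprn_gt0.
rewrite ballEmdist => y /= xy; rewrite /cylinder /= -[RHS]xw.
apply/eq_in_map => i; rewrite mem_iota /= add0n => iw.
apply/eqP; apply: contraTT xy; rewrite -leNgt eq_sym => /d2_ge; apply: le_trans.
by rewrite lef_pV2 ?posrE ?exprn_gt0// ler_weXn2l ?ler1n// ltnW.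
Qed.

Lemma ball_cylinder (x : T) (e : R) : 0 < e ->
  exists k, cyl (mkseq x k) `<=` ball x e.
Proof.
move=> e0; have [k _ /(_ k (leqnn k))] := near_infty_natSinv_expn_lt (PosNum e0).
rewrite div1r /= => ke; exists k => y; rewrite /cylinder /= size_mkseq => yx.
rewrite ballEmdist /=; apply: le_lt_trans ke.
rewrite /mdist /= /d2; case: pselect => [ex|_]; last by rewrite invr_ge0 exprn_ge0.
case: ex_minnP => j xyj _; rewrite lef_pV2 ?posrE ?exprn_gt0// ler_weXn2l ?ler1n//.
rewrite leqNgt; apply: contra xyj => jk.
by move/(congr1 (fun s => nth false s j)): yx; rewrite !nth_mkseq// => ->.
Qed.

Lemma open_bigcup_cylinder (U : set T) : open U ->
  U = \bigcup_(w in [set w | cyl w `<=` U]) cyl w.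
Proof.
rewrite openE => oU; apply/seteqP; split=> [x Ux|x [w wU /wU]//].
have /nbhs_ballP [e /= e0 eU] := oU x Ux.
have [k kU] := ball_cylinder x e0.
exists (mkseq x k); first exact: subset_trans eU.
by rewrite /cylinder /= size_mkseq.
Qed.

Lemma measurable_cylinder w : measurable (cyl w).
Proof. by apply: sub_sigma_algebra; exact: open_cylinder. Qed.

(** [set0] is listed because cylinders of incompatible words do not meet; the family is thus closed
    under intersection. *)
Definition cylinders : set (set T) := [set A | A = set0 \/ exists w, A = cyl w].

(** There are countably many words, so every open set is a countable union of cylinders. *)
Lemma cylinders_generate : @measurable _ T = <<s cylinders >>.
Proof.
apply/seteqP; split; last first.
  apply: smallest_sub; first exact: sigma_algebra_measurable.
  by move=> A [->//|[w ->]]; exact: measurable_cylinder.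
apply: smallest_sub; first exact: smallest_sigma_algebra.
move=> U /open_bigcup_cylinder ->.
rewrite bigcup_mkcond.
apply: (@countable_bigcupT_measurable _ (g_sigma_algebraType cylinders)) => //.
move=> w; case: ifP => _; last exact: measurable0.
by apply: sub_sigma_algebra; right; exists w.
Qed.

Lemma cylinders_setI : setI_closed cylinders.
Proof.
move=> A B [->|[v ->]]; first by rewrite set0I; left.
move=> [->|[w ->]]; first by rewrite setI0; left.
case: (leqP (size v) (size w)) => [vw|/ltnW wv].
  by rewrite cylinderI//; case: ifP; [right; exists w|left].
by rewrite setIC cylinderI//; case: ifP; [right; exists v|left].
Qed.

Lemma cylinder_measure_unique (m1 m2 : {measure set T -> \bar R}) :
  (forall w, m1 (cyl w) = m2 (cyl w)) -> (m1 setT < +oo)%E ->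
  forall A, measurable A -> m1 A = m2 A.
Proof.
move=> m12 fin; apply: (@measure_unique _ _ _ cylinders (fun=> setT)) => //.
- exact: cylinders_generate.
- exact: cylinders_setI.
- by move=> _; right; exists [::]; rewrite cylinder_nil.
- by rewrite bigcup_const//; exists 0%N.
- by move=> A [->|[w ->]//]; rewrite !measure0.
Qed.

Lemma measurable_shift : measurable_fun setT shift.
Proof.
apply: (@measurability _ _ _ _ _ _ cylinders); first exact: cylinders_generate.
move=> _ [B [->|[w ->]] <-]; rewrite setTI ?preimage_set0//.
rewrite -[X in measurable X]setTI -cylinder_bool setIUl -!cylinder_cons.
by apply: measurableU; exact: measurable_cylinder.
Qed.

Lemma measurable_preimage_shift A : measurable A -> measurable (shift @^-1` A).
Proof. by move=> mA; rewrite -[X in measurable X]setTI; exact: measurable_shift. Qed.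

Lemma measurable_preimage_iter k A :
  measurable A -> measurable (iter k shift @^-1` A).
Proof.
elim: k A => // k IH A mA; have := measurable_preimage_shift mA => /IH.
by congr (measurable _).
Qed.

End cylinders.

(** * The chain of runs *)

Section chain.
Context {R : realType} (m : nat) (hm : (3 <= m)%N) (p : R) (hp : 0 < p < 1).

Definition prob (b : bool) : R := if b then 1 - p else p.

(* The last digit and the length of the current run; length 0 stands for the
   empty past.  In a run of length [m.-1], [ordS] wraps around to 0, but that
   transition has weight 0. *)
Definition state : Type := (bool * 'I_m)%type.

(** The proofs carried by [Ordinal] fix the run length: 0 in [start], 1 in [fresh]. The digit of
    [start] is a dummy. *)
Definition start (b : bool) : state := (b, Ordinal (ltnW (ltnW hm))).

Definition fresh (b : bool) : state := (b, Ordinal (ltnW hm)).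

Definition step (s : state) (b : bool) : state :=
  if b == s.1 then (b, ordS s.2) else fresh b.

Definition run (s : state) (w : seq bool) : state := foldl step s w.

Definition weight (s : state) (b : bool) : R :=
  if s.2.+1 == m :> nat then (b != s.1)%:R else prob b.

Fixpoint wordweight (s : state) (w : seq bool) : R :=
  if w is b :: w' then weight s b * wordweight (step s b) w' else 1.

(** Markov operator of the chain; its [k]-th iterate gives the mean of [h] after [k] steps. *)
Definition transfer (h : state -> R) (s : state) : R :=
  weight s false * h (step s false) + weight s true * h (step s true).

Definition pmin : R := Num.min p (1 - p).

Implicit Types (s : state) (b : bool) (w : seq bool) (h : state -> R).

Lemma p_gt0 : 0 < p. Proof. by case/andP: hp. Qed.

Lemma p_lt1 : p < 1. Proof. by case/andP: hp. Qed.

Lemma prob_gt0 b : 0 < prob b.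
Proof. by rewrite /prob; case: b; rewrite ?subr_gt0 ?p_gt0 ?p_lt1. Qed.

Lemma pmin_gt0 : 0 < pmin.
Proof. by rewrite lt_min p_gt0 subr_gt0 p_lt1. Qed.

Lemma pmin_le1 : pmin <= 1.
Proof. by rewrite ge_min ltW// p_lt1. Qed.

Lemma pmin_prob b : pmin <= prob b.
Proof. by rewrite /prob ge_min; case: b; rewrite lexx ?orbT. Qed.

Lemma weight_ge0 s b : 0 <= weight s b.
Proof. by rewrite /weight; case: ifP => _; [exact: ler0n|exact/ltW/prob_gt0]. Qed.

Lemma weightD s : weight s false + weight s true = 1.
Proof.
rewrite /weight; case: ifP => _; last by rewrite /prob; lra.
by case: s.1 => /=; lra.
Qed.

Lemma pmin_weight s b : (b != s.1) || (s.2.+1 < m)%N -> pmin <= weight s b.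
Proof.
rewrite /weight; case: (eqVneq s.2.+1 m) => [->|_ _]; last exact: pmin_prob.
by rewrite ltnn orbF => ->; exact: pmin_le1.
Qed.

Lemma wordweight_ge0 s w : 0 <= wordweight s w.
Proof. by elim: w s => //= b w IH s; rewrite mulr_ge0 ?weight_ge0. Qed.

Lemma wordweight_cat s v w :
  wordweight s (v ++ w) = wordweight s v * wordweight (run s v) w.
Proof. by elim: v s => [|b v IH] s /=; rewrite ?mul1r// IH mulrA. Qed.

Lemma run_rcons s w b : run s (rcons w b) = step (run s w) b.
Proof. by rewrite /run foldl_rcons. Qed.

Lemma wordweight_rcons s w b :
  wordweight s (rcons w b) = wordweight s w * weight (run s w) b.
Proof. by rewrite -cats1 wordweight_cat /= mulr1. Qed.

Lemma fst_step s b : (step s b).1 = b.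
Proof. by rewrite /step; case: ifP. Qed.

Lemma val_step s b : (s.2.+1 < m)%N ->
  (step s b).2 = (if b == s.1 then s.2.+1 else 1%N) :> nat.
Proof. by move=> sm; rewrite /step; case: ifP => //= _; rewrite modn_small. Qed.

(** * Iterates of the Markov operator and their convergence *)

Lemma transfer_iterD h g k s :
  iter k transfer (fun s => h s + g s) s = iter k transfer h s + iter k transfer g s.
Proof.
elim: k s => //= k IH s; rewrite /transfer !IH; ring.
Qed.

Lemma transfer_iterZ h c k s :
  iter k transfer (fun s => c * h s) s = c * iter k transfer h s.
Proof. elim: k s => //= k IH s; rewrite /transfer !IH; ring. Qed.

Lemma transfer_iter_sum (I : Type) (r : seq I) (h : I -> state -> R) k s :
  iter k transfer (fun s => \sum_(i <- r) h i s) s =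
  \sum_(i <- r) iter k transfer (h i) s.
Proof.
elim: r => [|i r IH].
  under [X in iter k transfer X]eq_fun do rewrite big_nil.
  rewrite big_nil; elim: k s => //= k IH s; rewrite /transfer !IH; ring.
under [X in iter k transfer X]eq_fun do rewrite big_cons.
by rewrite transfer_iterD IH big_cons.
Qed.

(** Reduces any [h] to indicators of states, whose iterates are the [k]-step transition
    probabilities. *)
Lemma transfer_iter_dirac h k s :
  iter k transfer h s = \sum_t h t * iter k transfer (fun u => (u == t)%:R) s.
Proof.
have {1}-> : h = fun u => \sum_t h t * (u == t)%:R.
  apply/funext => u; rewrite (bigD1 u)//= eqxx mulr1 big1 ?addr0// => t tu.
  by rewrite eq_sym (negbTE tu) mulr0.
by rewrite transfer_iter_sum; apply: eq_bigr => t _; rewrite transfer_iterZ.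
Qed.

Lemma transfer_ge c h : (forall s, c <= h s) -> forall s, c <= transfer h s.
Proof.
move=> ch s; rewrite /transfer -[c]mul1r -(weightD s) mulrDl.
by apply: lerD; apply: ler_wpM2l => //; exact: weight_ge0.
Qed.

Lemma transfer_le c h : (forall s, h s <= c) -> forall s, transfer h s <= c.
Proof.
move=> ch s; rewrite /transfer -[leRHS]mul1r -(weightD s) mulrDl.
by apply: lerD; apply: ler_wpM2l => //; exact: weight_ge0.
Qed.

Lemma transfer_iter_ge c h k s : (forall s, c <= h s) -> c <= iter k transfer h s.
Proof. by move=> ch; elim: k s => //= k IH s; exact: transfer_ge. Qed.

Lemma transfer_iter_le c h k s : (forall s, h s <= c) -> iter k transfer h s <= c.
Proof. by move=> ch; elim: k s => //= k IH s; exact: transfer_le. Qed.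

Lemma transfer_iter_cst c k s : iter k transfer (fun=> c) s = c.
Proof.
by apply: le_anti; rewrite transfer_iter_le ?transfer_iter_ge.
Qed.

Lemma wordweight_transfer h w s : (forall s, 0 <= h s) ->
  wordweight s w * h (run s w) <= iter (size w) transfer h s.
Proof.
move=> h0; elim: w s => [|b w IH] s; rewrite ?mul1r//= -mulrA.
have P0 t : 0 <= iter (size w) transfer h t by exact: transfer_iter_ge.
apply: (le_trans (ler_wpM2l (weight_ge0 s b) (IH (step s b)))).
by rewrite /transfer; case: b; rewrite ?lerDl ?lerDr mulr_ge0 ?weight_ge0.
Qed.

(* From any state one reaches a fresh run of [b] in exactly three steps; the word
   [~~ b, ~~ b, b] is allowed because [3 <= m]. *)
Lemma doeblin b h s : (forall s, 0 <= h s) ->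
  pmin ^+ 3 * h (fresh b) <= iter 3 transfer h s.
Proof.
(* A run of [b] has to be left and entered anew, and repeating [~~ b] brings the length to three.
   From a run of [~~ b], three changes of digit do it. *)
move=> h0; set w := if s.1 == b then [:: ~~ b; ~~ b; b] else [:: b; ~~ b; b].
have sz : size w = 3%N by rewrite /w; case: ifP.
have rw : run s w = fresh b.
  by rewrite /w /run {w sz}; case: s => [[] r]; case: b.
rewrite -rw -[X in iter X]sz; apply: le_trans (wordweight_transfer w s h0).
rewrite rw ler_wpM2r// !exprS expr0 /w.
have p0 := ltW pmin_gt0; have m1 := ltnW hm.
have snd_fresh c c' : c != c' -> forall t, t.1 = c -> step t c' = fresh c'.
  by move=> cc' t tc; rewrite /step tc eq_sym (negbTE cc').
case: eqVneq => [sb|sb] /=; do !apply: ler_pM; rewrite ?mulr_ge0// ?mulr1//;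
  apply: pmin_weight.
- by rewrite sb; case: (b).
- by rewrite (snd_fresh b (~~ b) _ s sb) /= ?hm ?orbT//; case: (b).
- by rewrite fst_step; case: (b).
- by rewrite eq_sym sb.
- by rewrite fst_step; case: (b).
- by rewrite fst_step; case: (b).
Qed.

(** The maximum and the minimum over the states are monotone in [k], and by [doeblin] their gap
    shrinks by the factor [1 - pmin ^+ 3] every three steps. *)
Lemma transfer_cvg h :
  exists c : R, forall s, iter k transfer h s @[k --> \oo] --> c.
Proof.
pose s0 := start false.
pose M k := \big[Num.max/iter k transfer h s0]_s iter k transfer h s.
pose N k := \big[Num.min/iter k transfer h s0]_s iter k transfer h s.
have leM k s : iter k transfer h s <= M k by exact: le_bigmax.
have geN k s : N k <= iter k transfer h s by exact: Order.TotalTheory.bigmin_le_cond.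
have Mle c k : (forall s, iter k transfer h s <= c) -> M k <= c.
  by move=> hc; apply/bigmax_leP; split.
have Nge c k : (forall s, c <= iter k transfer h s) -> c <= N k.
  by move=> hc; apply/Order.TotalTheory.bigmin_geP; split.
have Mni : nonincreasing_seq M.
  apply/nonincreasing_seqP => k; apply: Mle => s; exact: transfer_le (leM k) s.
have Nnd : nondecreasing_seq N.
  apply/nondecreasing_seqP => k; apply: Nge => s; exact: transfer_ge (geN k) s.
have NM k : N k <= M k := le_trans (geN k s0) (leM k s0).
have Mcv : cvgn M.
  apply: nonincreasing_is_cvgn => //; exists (N 0%N) => _ [k _ <-].
  by apply: le_trans (NM k); exact: Nnd.
have Ncv : cvgn N.
  apply: nondecreasing_is_cvgn => //; exists (M 0%N) => _ [k _ <-].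
  by apply: le_trans (NM k) _; exact: Mni.
have contr k : M (3 + k)%N - N (3 + k)%N <= (1 - pmin ^+ 3) * (M k - N k).
  set t := fresh false; set ut := iter k transfer h t.
  (* [doeblin] is applied to the iterate minus [N k], and in [hi] to [M k] minus the iterate; both
     are nonnegative. *)
  have lo s : N k + pmin ^+ 3 * (ut - N k) <= iter (3 + k) transfer h s.
    have := @doeblin false (fun s => iter k transfer h s + - N k) s.
    rewrite transfer_iterD transfer_iter_cst -iterD => H; rewrite -lerBrDl.
    by apply: H => u; rewrite subr_ge0.
  have hi s : iter (3 + k) transfer h s <= M k - pmin ^+ 3 * (M k - ut).
    have := @doeblin false (fun s => M k + -1 * iter k transfer h s) s.
    rewrite transfer_iterD transfer_iter_cst transfer_iterZ -iterD !mulN1r.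
    move=> H; have {H} : pmin ^+ 3 * (M k - ut) <= M k - iter (3 + k) transfer h s.
      by apply: H => u; rewrite mulN1r subr_ge0.
    by move=> H; rewrite lerBrDr -lerBrDl.
  have := Nge _ _ lo; have := Mle _ _ hi; lra.
have MN : limn M = limn N.
  have DC : (M k - N k) @[k --> \oo] --> limn M - limn N by exact: cvgB.
  have DC3 : (M (3 + k)%N - N (3 + k)%N) @[k --> \oo] --> limn M - limn N.
    rewrite -(cvg_shiftn 3) in DC; move: DC.
    by under eq_fun do rewrite addnC.
  (* The limit of the gap is at most [1 - pmin ^+ 3] times itself, hence nonpositive. *)
  have : limn M - limn N <= (1 - pmin ^+ 3) * (limn M - limn N).
    apply: ler_cvg_to DC3 (cvgM (cvg_cst _) DC) _ => //.
    by near=> k; exact: contr.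
  rewrite mulrBl mul1r lerDl oppr_ge0 pmulr_rle0 ?exprn_gt0 ?pmin_gt0//.
  rewrite subr_le0 => MN; apply/le_anti; rewrite MN.
  by apply: ler_cvg_to Ncv Mcv _; near=> k; exact: NM.
exists (limn M) => s.
apply: (@squeeze_cvgr _ _ _ _ N M) => //; last by rewrite MN.
by near=> k; rewrite leM geN.
Unshelve. all: by end_near.
Qed.

(** * Allowed words and the masses of cylinders *)

Local Notation T := (Lambda R hm).
Local Notation cyl := (@cylinder R m hm).
Local Notation shift := (@sigma_shift R m hm).
Implicit Types (t : state) (c : bool) (v : seq bool).

(** Differs from [word] by admitting the empty word, where the inductions start. *)
Definition allowed w := ~~ infix (nseq m false) w && ~~ infix (nseq m true) w.

Lemma allowedP w : reflect (forall b, ~~ infix (nseq m b) w) (allowed w).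
Proof.
by apply: (iffP andP) => [[? ?] []//|h]; split; exact: h.
Qed.

Lemma suffix_nseq_rcons k b w c : suffix (nseq k.+1 b) (rcons w c) =
  (b == c) && suffix (nseq k b) w.
Proof. by rewrite nseqSr suffix_rcons. Qed.

Lemma cylinder_forbidden w : ~~ allowed w -> cyl w = set0.
Proof.
by move=> /allowedP h; have /existsNP [b /negP/negPn] := h; exact: cylinder_infix.
Qed.

(** In an allowed word no run reaches length [m], so [ordS] never wraps around and the state records
    the longest constant suffix. *)
Lemma suffix_run w : allowed w -> forall k b, suffix (nseq k b) w =
  (k == 0)%N || (b == (run (start false) w).1) && (k <= (run (start false) w).2)%N.
Proof.
elim/last_ind: w => [_ [|k] b|w c IH /allowedP wc k b].
- by rewrite /= suffix0s.
- by rewrite /= andbF suffixs0.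
have aw : allowed w.
  by apply/allowedP => d; have := wc d; rewrite infix_rconsl negb_or => /andP[].
case: k => [|k]; first by rewrite suffix0s.
rewrite suffix_nseq_rcons IH// run_rcons fst_step /=.
have [->|//] := eqVneq b c; rewrite /= /step.
have [cs|cs] /= := eqVneq c (run (start false) w).1; last by case: k.
rewrite modn_small ?ltnS//; first by case: k.
have := wc c; rewrite infix_rconsl negb_or => /andP[+ _].
rewrite -[X in nseq X](ltn_predK (ltnW (ltnW hm))) suffix_nseq_rcons.
rewrite eqxx IH// cs eqxx /=.
by rewrite negb_or -ltnNge; have := ltn_ord (run (start false) w).2; lia.
Qed.

(** A forbidden block created by a new last digit is a suffix, so [suffix_run] reduces the test to
    the state. *)
Lemma allowed_rcons w c : allowed w -> allowed (rcons w c) =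
  ((run (start false) w).2.+1 < m)%N || (c != (run (start false) w).1).
Proof.
move=> aw; have aw' := allowedP _ aw.
have E b : ~~ infix (nseq m b) (rcons w c) = [|| b != c,
    ((run (start false) w).2.+1 < m)%N | b != (run (start false) w).1].
  rewrite infix_rconsl (negbTE (aw' b)) orbF.
  rewrite -[X in nseq X](ltn_predK (ltnW (ltnW hm))) suffix_nseq_rcons suffix_run//.
  rewrite negb_and; congr orb.
  rewrite (_ : m.-1 == 0 = false)%N; last by apply/negbTE; lia.
  rewrite negb_and orbC -ltnNge; congr orb.
  by have := ltn_ord (run (start false) w).2; lia.
by rewrite /allowed !E; case: (c) => /=; rewrite ?andbT.
Qed.

Section bernoulli_type.
Context (mu : {measure set T -> \bar R}) (hmu : is_bernoulli_type p mu).

Lemma bernoulli_cylinder w : mu (cyl w) = (wordweight (start false) w)%:E.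
Proof.
case: hmu => mu1 mu_false mu_true mu_rcons.
elim/last_ind: w => [|w c IH]; first by rewrite cylinder_nil.
rewrite wordweight_rcons.
have [aw|] := boolP (allowed w); last first.
  (* For a forbidden [w] the induction hypothesis says that its weight is 0, so both sides vanish
     for the extension. *)
  move=> /cylinder_forbidden w0; move: IH; rewrite w0 measure0 => -[<-].
  have -> : cyl (rcons w c) = set0.
    by rewrite -subset0 -w0; exact: cylinder_rcons_sub.
  by rewrite mul0r measure0.
have [->|wn] := eqVneq w [::].
  rewrite mul1r /weight /= ifF; last by apply/negbTE; lia.
  by case: c {IH}.
have /mu_rcons [both only_false only_true] : word m w.
  by rewrite /word lt0n size_eq0 wn.
have wordE b : word m (rcons w b) = allowed (rcons w b).
  by rewrite /word size_rcons.
move: both only_false only_true; rewrite !wordE !allowed_rcons// IH -!EFinM.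
rewrite /weight; have [sm|] := ltnP; rewrite /= => both only_false only_true.
  rewrite ltn_eqF// mulrC.
  by case: c {IH}; case: (both isT isT).
(* The run is full: the only allowed extension is the opposite digit, which inherits the whole
   mass. *)
have -> : (run (start false) w).2.+1 == m :> nat.
  by have := ltn_ord (run (start false) w).2; lia.
have cyl0 d : ~~ allowed (rcons w d) -> mu (cyl (rcons w d)) = 0.
  by move=> /cylinder_forbidden ->; rewrite measure0.
move=> only_true'; have [cl|cl] := eqVneq c (run (start false) w).1.
  rewrite mulr0 cyl0//.
  by rewrite allowed_rcons// cl eqxx orbF -leqNgt.
rewrite mulr1.
case: c cl {IH cyl0}; case: (run (start false) w).1 only_false only_true only_true';
  rewrite //.
- by move=> _ _; apply.
- by move=> _ h _ _; exact: h.
Qed.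

Lemma weight_not_last s b : (s.2.+1 < m)%N -> weight s b = prob b.
Proof. by rewrite /weight => /ltn_eqF ->. Qed.

Lemma step_start b c : step (start b) c = fresh c.
Proof.
rewrite /step /=; case: eqP => // _; congr (_, _); apply/val_inj => /=.
by rewrite modn_small// ltnW.
Qed.

Lemma wordweight_start b c w : wordweight (start b) w = wordweight (start c) w.
Proof.
case: w => //= d w; rewrite !step_start; congr (_ * _).
by rewrite !weight_not_last//= ltnW.
Qed.

(** With [r] the inverse of the mass of [cyl v] this is the law of the future conditioned on [v];
    [r = 1] serves for the Markov property. *)
Lemma exists_measure_after (nu : {measure set T -> \bar R}) (r : R) v :
  0 <= r -> exists k : {measure set T -> \bar R}, forall B,
    k B = (r%:E * nu (cyl v `&` iter (size v) shift @^-1` B))%E.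
Proof.
move=> r0; have mv : measurable (cyl v) by exact: measurable_cylinder.
unshelve eexists
  (mscale (NngNum r0) (pushforward (mrestr nu mv) (iter (size v) shift))).
  by move=> _ B mB; rewrite setTI; exact: measurable_preimage_iter.
by move=> B; rewrite /= /mscale /= /pushforward /mrestr setIC.
Qed.

(** Induction on the run length: [mu] is the law at length 0, and conditioning the law at [(b, r)]
    on one more [b] gives the law at length [r.+1]. *)
Lemma exists_state_measure s : exists nu : {measure set T -> \bar R},
  forall w, nu (cyl w) = (wordweight s w)%:E.
Proof.
case: s => b [r rm]; elim: r rm => [|r IH] rm.
  exists mu => w; rewrite bernoulli_cylinder (wordweight_start _ b).
  by congr (wordweight (_, _) _)%:E; apply/val_inj.
have [nu hnu] := IH (ltnW rm).
have p0 := prob_gt0 b.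
have [k kE] : exists k : {measure set T -> \bar R}, forall B,
    k B = ((prob b)^-1%:E * nu (cyl [:: b] `&` shift @^-1` B))%E.
  by apply: (@exists_measure_after _ _ [:: b]); rewrite invr_ge0 ltW.
exists k => w; rewrite kE -cylinder_cons hnu /= weight_not_last//.
rewrite -EFinM mulKf ?gt_eqF//; congr (wordweight _ w)%:E.
rewrite /step /= eqxx; congr (_, _); apply/val_inj => /=.
by rewrite modn_small.
Qed.

End bernoulli_type.

(** * The laws of the future given the state *)

Section state_measures.
Local Open Scope ereal_scope.
Implicit Types (A B : set T).
Context (nu : state -> {measure set T -> \bar R}).
Hypothesis nu_cylinder : forall s w, nu s (cyl w) = (wordweight s w)%:E.

Lemma nu_setT s : nu s setT = 1.
Proof. by rewrite -cylinder_nil nu_cylinder. Qed.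

Lemma nu_fin_num s B : measurable B -> nu s B \is a fin_num.
Proof.
move=> mB; rewrite ge0_fin_numE//; apply: (@le_lt_trans _ _ 1); last exact: ltry.
by rewrite -(nu_setT s); apply: le_measure => //; rewrite inE.
Qed.

(** Markov property: both sides are finite measures in [B] that agree on cylinders, as weights
    multiply along concatenation. *)
Lemma nu_markov s v B : measurable B ->
  nu s (cyl v `&` iter (size v) shift @^-1` B) =
  (wordweight s v)%:E * nu (run s v) B.
Proof.
move=> mB; have [k kE] := exists_measure_after (nu s) v (@ler01 R).
rewrite -[LHS]mul1e -kE.
pose r := NngNum (wordweight_ge0 s v).
apply: (@cylinder_measure_unique _ _ _ k (mscale r (nu (run s v)))) => //.
  move=> w; rewrite kE mul1e -cylinder_cat nu_cylinder wordweight_cat EFinM.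
  by rewrite -[RHS]/(_ * nu _ (cyl w)) nu_cylinder.
rewrite kE mul1e preimage_setT setIT nu_cylinder; exact: ltry.
Qed.

Lemma nu_shift s B : measurable B ->
  fine (nu s (shift @^-1` B)) = transfer (fun t => fine (nu t B)) s.
Proof.
move=> mB; have mS : measurable (shift @^-1` B) by exact: measurable_preimage_shift.
have E b : nu s (cyl [:: b] `&` shift @^-1` B) = (weight s b)%:E * nu (step s b) B.
  by have := nu_markov s [:: b] mB; rewrite /= mulr1.
have mSb b : measurable (cyl [:: b] `&` shift @^-1` B).
  by apply: measurableI => //; exact: measurable_cylinder.
have -> : nu s (shift @^-1` B) = nu s (cyl [:: false] `&` shift @^-1` B) +
    nu s (cyl [:: true] `&` shift @^-1` B).
  rewrite -[in LHS](setTI (shift @^-1` B)) -cylinder_bool setIUl measureU//.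
  by rewrite setIACA cylinder_trivI// set0I.
by rewrite !E fineD ?fin_numM ?nu_fin_num// !fineM ?nu_fin_num.
Qed.

Lemma nu_iter_shift k s B : measurable B ->
  fine (nu s (iter k shift @^-1` B)) = iter k transfer (fun t => fine (nu t B)) s.
Proof.
move=> mB; elim: k s => // k IH s; rewrite iterS -[in RHS](funext IH).
rewrite -nu_shift; last exact: measurable_preimage_iter.
by congr (fine (nu s _)); apply/seteqP; split=> x; rewrite /= -iterSr.
Qed.

(** After [v] both chains are in the same state, so the two laws are proportional on [cyl v]. The
    cross-multiplied form covers weights equal to 0. *)
Lemma nu_coalesce s t v B : run s v = run t v -> measurable B ->
  (wordweight t v)%:E * nu s (B `&` cyl v) =
  (wordweight s v)%:E * nu t (B `&` cyl v).
Proof.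
move=> stv mB; have mv : measurable (cyl v) by exact: measurable_cylinder.
pose r u := NngNum (wordweight_ge0 u v).
apply: (@cylinder_measure_unique _ _ _
  (mscale (r t) (mrestr (nu s) mv)) (mscale (r s) (mrestr (nu t) mv))) => //.
  move=> w; rewrite -[LHS]/(_ * nu s (cyl w `&` cyl v)).
  rewrite -[RHS]/(_ * nu t (cyl w `&` cyl v)).
  have [wv|/ltnW vw] := leqP (size w) (size v).
    rewrite cylinderI//; case: ifP => _; last by rewrite !measure0 !mule0.
    by rewrite !nu_cylinder -!EFinM mulrC.
  rewrite setIC cylinderI//; case: ifP => [|_]; last by rewrite !measure0 !mule0.
  move=> /prefixP [u ->]; rewrite !nu_cylinder !wordweight_cat stv -!EFinM.
  by congr _%:E; rewrite mulrCA.
by rewrite -[X in X < _]/(_ * nu s (setT `&` cyl v)) setTI nu_cylinder -EFinM ltry.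
Qed.

Lemma nu_coalesce0 s t v B : run s v = run t v -> (0 < wordweight t v)%R ->
  measurable B -> nu t B = 0 -> nu s (B `&` cyl v) = 0.
Proof.
move=> stv t0 mB B0; have mv : measurable (cyl v) by exact: measurable_cylinder.
have := nu_coalesce stv mB.
rewrite (subset_measure0 _ mB _ B0)//; last exact: measurableI.
by rewrite mule0 => /eqP; rewrite mule_eq0 eqe gt_eqF//= => /eqP.
Qed.

(** * Comparison of null sets through the next change of digit *)

Definition turn b (j : nat) : seq bool := rcons (nseq j b) (~~ b).

(** When the current digit is not [b] and [j] is 0, the closing [~~ b] prolongs the current run;
    hence the bound on [t.2] in that branch. *)
Lemma turn_wordweight_gt0 t b j :
  (if t.1 == b then (t.2 + j < m)%N else (t.2.+1 < m)%N && (j < m)%N) ->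
  (0 < wordweight t (turn b j))%R.
Proof.
elim: j t => [|j IH] t h /=.
  rewrite mulr1 (lt_le_trans pmin_gt0)// pmin_weight//.
  by move: h; case: eqVneq => [->|_ /andP[->]]; [case: (b)|rewrite orbT].
have tm : (t.2.+1 < m)%N.
  move: h; case: ifP => _; last by case/andP.
  by rewrite addnS; apply: leq_ltn_trans; rewrite ltnS leq_addr.
rewrite mulr_gt0//.
  by rewrite (lt_le_trans pmin_gt0)// pmin_weight// tm orbT.
apply: IH; rewrite fst_step eqxx val_step//.
move: h; rewrite eq_sym; case: ifP => _; first by rewrite addSnnS.
by case/andP.
Qed.

(** The change of digit erases the past; for [j = 0] it is a change only if [s] is in a run of
    [b]. *)
Lemma run_turn s b j : (0 < j)%N || (s.1 == b) -> run s (turn b j) = fresh (~~ b).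
Proof.
rewrite /turn run_rcons; case: j => [/eqP sb|j _].
  by rewrite /step /= sb; case: (b).
by rewrite nseqSr run_rcons {1}/step fst_step; case: (b).
Qed.

(** Since [x] contains no block of [m] digits [b], its first digit other than [b] has index below
    [m]. *)
Lemma turn_cover b (x : T) : exists2 j, (j < m)%N & cyl (turn b j) x.
Proof.
have ex : exists j, x j != b.
  apply: contrapT => /forallNP h; have /eqP := digitP x b 0; apply.
  apply: (@eq_from_nth _ b); rewrite ?size_mkseq ?size_nseq// => i im.
  by rewrite nth_mkseq// nth_nseq im add0n; apply/eqP/negPn/negP; exact: h.
have [j xj jmin] := ex_minnP ex.
have low i : (i < j)%N -> x i = b.
  by move=> ij; apply/eqP; apply: contraTT ij; rewrite -leqNgt; exact: jmin.
exists j.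
  rewrite ltnNge; apply/negP => mj; have /eqP := digitP x b 0; apply.
  apply: (@eq_from_nth _ b); rewrite ?size_mkseq ?size_nseq// => i im.
  by rewrite nth_mkseq// nth_nseq im add0n low// (leq_trans im).
rewrite /cylinder /turn /= size_rcons size_nseq.
apply: (@eq_from_nth _ b); rewrite ?size_mkseq ?size_rcons ?size_nseq// => i ij.
rewrite nth_mkseq// nth_rcons size_nseq nth_nseq.
have [/low ->//|ji] := ltnP i j.
have -> : i = j by apply/eqP; rewrite eqn_leq ji andbT -ltnS.
by rewrite eqxx; case: (x j) (b) xj => -[].
Qed.

Lemma nu_turn0 s b B : measurable B ->
  (forall j, (j < m)%N -> nu s (B `&` cyl (turn b j)) = 0) -> nu s B = 0.
Proof.
move=> mB h.
have mBj j : measurable (B `&` cyl (turn b j)).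
  by apply: measurableI => //; exact: measurable_cylinder.
have BE : B = \bigcup_(j < m) (B `&` cyl (turn b j)).
  apply/seteqP; split=> [x Bx|x [j _ []]//].
  by have [j jm xj] := turn_cover b x; exists j.
rewrite bigcup_mkord in BE.
have := Boole_inequality (nu s) (fun j _ => mBj j).
move=> /(_ m); rewrite -BE big1 => [B0|j _]; last exact: h.
by apply/le_anti; rewrite measure_ge0 andbT.
Qed.

(** Split by the end of the current run of [s.1]: each such word leads [s] and [start false] to the
    same state and has positive weight from [start false]. *)
Lemma nu_start_dominates s B : measurable B -> nu (start false) B = 0 -> nu s B = 0.
Proof.
move=> mB B0; apply: (@nu_turn0 s s.1) => // j jm.
have st : run s (turn s.1 j) = run (start false) (turn s.1 j).
  case: j jm => [|j] jm; last by rewrite !run_turn.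
  by rewrite run_turn ?eqxx ?orbT// /turn /= step_start.
apply: nu_coalesce0 st _ mB B0; apply: turn_wordweight_gt0 => /=.
by rewrite jm (ltnW hm); case: ifP.
Qed.

Lemma nu_fresh_dominate B : measurable B ->
  (forall b, nu (fresh b) B = 0) -> nu (start false) B = 0.
Proof.
move=> mB B0.
have half b : nu (start false) (B `&` cyl [:: b]) = 0.
  have mBb : measurable (B `&` cyl [:: b]).
    by apply: measurableI => //; exact: measurable_cylinder.
  apply: (@nu_turn0 _ b) => // -[|j] jm.
    by rewrite -setIA cylinder_trivI ?setI0 ?measure0//; case: (b).
  (* The comparison state is [fresh (~~ b)]: from [fresh b] the word with [j = m.-1] would complete
     a forbidden block and have weight 0. *)
  apply: (@nu_coalesce0 _ (fresh (~~ b))) => //.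
  - by rewrite !run_turn.
  - apply: turn_wordweight_gt0 => /=; rewrite hm jm.
    by case: (b).
  - by apply: subset_measure0 (B0 (~~ b)).
have -> : nu (start false) B = nu (start false) (B `&` cyl [:: false]) +
    nu (start false) (B `&` cyl [:: true]).
  rewrite -[in LHS](setIT B) -cylinder_bool setIUr measureU//.
  - by apply: measurableI => //; exact: measurable_cylinder.
  - by apply: measurableI => //; exact: measurable_cylinder.
  - by rewrite setIACA cylinder_trivI// setI0.
by rewrite !half adde0.
Qed.

(** * Stationary probabilities and the limit measure *)

Lemma exists_weighted_sum (r : seq state) (f : state -> R) :
  (forall s, 0 <= f s)%R ->
  exists k : {measure set T -> \bar R}, forall B,
    k B = \sum_(s <- r) (f s)%:E * nu s B.
Proof.
move=> f0; elim: r => [|s r [k kE]].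
  by exists mzero => B; rewrite big_nil.
exists (measure_add (mscale (NngNum (f0 s)) (nu s)) k) => B.
by rewrite [LHS]measure_addE big_cons -kE.
Qed.

(** [lam] is the mixture of the laws [nu t] with the stationary probabilities [f t]. By [doeblin]
    the fresh states have positive probability, which is what [nu_fresh_dominate] calls for. *)
Lemma exists_limit_probability : exists lam : probability T R,
  [/\ forall s B, measurable B ->
        fine (nu s (iter k shift @^-1` B)) @[k --> \oo] --> fine (lam B),
      forall B, (forall s, nu s B = 0) -> lam B = 0
    & forall B, lam B = 0 -> forall b, nu (fresh b) B = 0].
Proof.
have /choice[f f_cvg] : forall t, exists c : R, forall s,
    iter k transfer (fun u => (u == t)%:R) s @[k --> \oo] --> c.
  by move=> t; exact: transfer_cvg.
pose s0 := start false.
(* A lower bound valid from every state at time [n] persists at later times, hence in the limit. *)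
have f_ge (c : R) t n :
    (forall s, c <= iter n transfer (fun u => (u == t)%:R) s)%R -> (c <= f t)%R.
  move=> h; have ft := f_cvg t s0.
  apply: (ler_cvg_to (cvg_cst c) ft); near=> k.
  have nk : (n <= k)%N by near: k; exact: nbhs_infty_ge.
  by rewrite -(subnK nk) iterD; exact: transfer_iter_ge.
have f_ge0 t : (0 <= f t)%R by apply: (f_ge _ _ 0%N) => s; exact: ler0n.
have f_gt0 b : (0 < f (fresh b))%R.
  apply: (@lt_le_trans _ _ (pmin ^+ 3)%R); first by rewrite exprn_gt0// pmin_gt0.
  apply: (f_ge _ _ 3%N) => s; apply: le_trans (doeblin b s _) => [|u].
    by rewrite eqxx mulr1.
  exact: ler0n.
have [k kE] := exists_weighted_sum (enum {: state}) f_ge0.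
have k_cvg s B : measurable B ->
    fine (nu s (iter k shift @^-1` B)) @[k --> \oo] --> fine (k B).
  move=> mB.
  have -> : fine (k B) = (\sum_t fine (nu t B) * f t)%R.
    rewrite kE big_enum /= -sum_fine => [|t _].
      apply: eq_bigr => t _.
      by rewrite fineM ?nu_fin_num// mulrC.
    by rewrite fin_numM ?nu_fin_num.
  under eq_fun do rewrite nu_iter_shift// transfer_iter_dirac.
  apply: cvg_big => [|t _]; first exact: add_continuous.
  by apply: cvgM; [exact: cvg_cst|exact: f_cvg].
have k1 : k setT = 1.
  rewrite -(@fineK _ (k setT)); last first.
    rewrite kE sum_fin_num; apply/allP => _ /mapP[t _ ->].
    by apply: fin_numM => //; exact: nu_fin_num.
  congr _%:E; rewrite -(cvg_lim _ (k_cvg s0 setT measurableT))//.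
  under eq_fun do rewrite preimage_setT nu_setT.
  exact: lim_cst.
(* [k] already has mass 1, so normalising leaves it unchanged and only makes it a [probability]; the
   Dirac mass is a default value. *)
pose lam : probability T R := mnormalize k (dirac point).
have lamE B : lam B = k B.
  by rewrite /lam /= /mnormalize k1 onee_eq0 /= invr1 mule1.
exists lam; split=> [s B mB|B B0|B]; rewrite ?lamE.
- exact: k_cvg.
- by rewrite kE big1// => s _; rewrite B0 mule0.
- rewrite kE => /eqP; rewrite seq_psume_eq0 => [/allP B0 b|t _].
    have := B0 (fresh b); rewrite mem_enum => /(_ isT) /=.
    by rewrite mule_eq0 eqe gt_eqF//= => /eqP.
  by rewrite mule_ge0// lee_fin.
Unshelve. all: by end_near.
Qed.

(* A shift-invariant set has a harmonic, hence constant, probability as a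
   function of the state; by the Markov property it is then independent of every
   cylinder, so of itself. *)
Lemma nu_invariant_01 A : measurable A -> shift @^-1` A = A ->
  exists2 c : R, (c = 0 \/ c = 1)%R & forall s, nu s A = c%:E.
Proof.
move=> mA invA; have fin s := nu_fin_num s mA.
have iterA k := iter_preimage_id k invA.
have [c c_cvg] := transfer_cvg (fun t => fine (nu t A)).
have nuA s : nu s A = c%:E.
  rewrite -(fineK (fin s)); congr _%:E.
  rewrite -(cvg_lim _ (c_cvg s))//.
  under eq_fun do rewrite -nu_iter_shift// iterA.
  by rewrite lim_cst.
exists c => //; pose s := start false.
have c0 : (0 <= c)%R by rewrite -lee_fin -(nuA s).
have := @cylinder_measure_unique R m hm
  (mrestr (nu s) mA) (mscale (NngNum c0) (nu s)).
move=> /(_ _ _ _ mA) ind.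
have : nu s (A `&` A) = c%:E * nu s A.
  apply: ind => [w|].
    rewrite -[LHS]/(nu s (cyl w `&` A)) -[X in _ `&` X](iterA (size w)).
    rewrite nu_markov// nuA muleC.
    by rewrite -[RHS]/(_ * nu s (cyl w)) nu_cylinder.
  by rewrite -[X in X < _]/(nu s (setT `&` A)) setTI nuA ltry.
rewrite setIid nuA -EFinM => -[cc].
have /eqP : (c * (1 - c) = 0)%R by rewrite mulrBr mulr1 -cc subrr.
by rewrite mulf_eq0 subr_eq0 => /orP[/eqP|/eqP/esym]; [left|right].
Qed.

End state_measures.

End chain.

(** * Invariance, ergodicity, equivalence and uniqueness of the limit *)

Local Open Scope ereal_scope.

Theorem theorem4p2 (R : realType) (m : nat) (hm : (3 <= m)%N) (p : R)
    (hp : (0 < p < 1)%R) (mu : {measure set (Lambda R hm) -> \bar R})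
    (hmu : is_bernoulli_type p mu) :
  exists lam : probability (Lambda R hm) R,
    [/\ forall B : set (Lambda R hm), measurable B ->
          (fun n : nat => (n%:R^-1)%:E *
             \sum_(0 <= k < n) pushforward mu (iter k (@sigma_shift R m hm)) B)
          @ \oo --> lam B,
        [/\ shift_invariant lam, ergodic lam & equivalent lam mu]
      & forall nu : probability (Lambda R hm) R,
          shift_invariant nu -> ergodic nu -> equivalent nu mu ->
          forall B : set (Lambda R hm), measurable B -> nu B = lam B].
Proof.
have /choice[nu nuE] := exists_state_measure hp hmu.
have [lam [lam_cvg lam0 lam0_fresh]] := exists_limit_probability hp nuE.
pose s0 := start hm false.
have muE B : measurable B -> mu B = nu s0 B.
  apply: cylinder_measure_unique => [w|]; last first.
    by have [-> _ _ _] := hmu; rewrite ltry.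
  by rewrite (bernoulli_cylinder hp hmu) nuE.
have lamK B : measurable B -> (fine (lam B))%:E = lam B.
  by move=> mB; rewrite fineK// fin_num_measure.
have inv : shift_invariant lam.
  move=> B mB; have mS := measurable_preimage_shift mB.
  rewrite -[RHS]lamK// -[LHS]lamK//; congr _%:E.
  (* The sequence for the preimage of [B] is the one for [B] moved by one index. *)
  have cB := lam_cvg s0 _ mB; rewrite -cvg_shiftS in cB.
  by rewrite -(cvg_lim _ cB)// -(cvg_lim _ (lam_cvg s0 _ mS)).
have erg : ergodic lam.
  move=> A mA invA; have [c c01 nuA] := nu_invariant_01 hp nuE mA invA.
  have iterA k := iter_preimage_id k invA.
  have : lam A = c%:E.
    rewrite -lamK//; congr _%:E; rewrite -(cvg_lim _ (lam_cvg s0 A mA))//.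
    under eq_fun do rewrite iterA nuA.
    exact: lim_cst.
  by case: c01 => ->; [left|right].
have lam_mu : lam `<< mu.
  apply/null_content_dominatesP => B mB B0; apply: lam0 => s.
  by apply: (nu_start_dominates hp nuE) => //; rewrite -muE.
have mu_lam : mu `<< lam.
  apply/null_content_dominatesP => B mB B0; apply: etrans (muE B mB) _.
  by apply: (nu_fresh_dominate hp nuE) => //; exact: lam0_fresh.
exists lam; split=> [B mB||nu' inv' _ [nu'_mu _] B mB].
(* The sequence itself converges, hence so do its arithmetic means. *)
- rewrite -lamK//; apply: cesaro_pushforward => [k|].
    by rewrite muE ?(nu_fin_num nuE)//; exact: measurable_preimage_iter.
  rewrite [X in X @ _ --> _](_ : _ =
      fun k => fine (nu s0 (iter k (@sigma_shift R m hm) @^-1` B))).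
    exact: lam_cvg.
  by apply/funext => k; rewrite muE//; exact: measurable_preimage_iter.
- by split=> //; split.
- apply: (ergodic_unique measurable_shift inv inv' erg) => //.
  exact: null_dominates_trans nu'_mu mu_lam.
Qed.
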